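(* Let $Z_q(n,k)$ denote the center of $\mathrm{Cl}_q(n,k)$. Then \[ Z_q(n,k)\cong \mathbb{k}[\mathbb{Z}_{2k}]\otimes\cdots\otimes\mathbb{k}[\mathbb{Z}_{2k}] = \mathbb{k}[\mathbb{Z}_{2k}^n] \] (group algebra of the product of $n$ cyclic groups of order $2k$). In particular, $Z_q(n,k)$ is generated by the elements of order $2k$ \[ z_a = q\omega_a - (q-1)\psi_a\psi_a^*\omega_a^{k+1},\qquad a=1,\dots,n. \] Moreover, $\dim Z_q(n,k)=(2k)^n$, and each $z_a$ satisfies $\psi_a\psi_a^*+\psi_a^*\psi_a = z_a^k$.
   Context: Let $\mathbb{k}$ be a field of characteristic different from $2$, let $q\in\mathbb{k}^\times$, and let $n,k$ be positive integers. The quantum Clifford algebra $\mathrm{Cl}_q(n,k)$ is the unital associative $\mathbb{k}$-algebra generated by $\psi_a,\psi_a^*,\omega_a,\omega_a^{-1}$ for $a\in\{1,\dots,n\}$, subject to the relations (for all $a,b\in\{1,\dots,n\}$): $\omega_a\omega_b=\omega_b\omega_a$; $\omega_a\omega_a^{-1}=1$; $\omega_a\psi_b=q^{\delta_{ab}}\psi_b\omega_a$; $\omega_a\psi_b^*=q^{-\delta_{ab}}\psi_b^*\omega_a$; $\psi_a\psi_b+\psi_b\psi_a=0$; $\psi_a^*\psi_b^*+\psi_b^*\psi_a^*=0$; $\psi_a\psi_a^*+q^k\psi_a^*\psi_a=\omega_a^{-k}$; $\psi_a\psi_a^*+q^{-k}\psi_a^*\psi_a=\omega_a^{k}$; and $\psi_a\psi_b^*+\psi_b^*\psi_a=0$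 if $a\neq b$. $\mathbb{Z}_{2k}=\mathbb{Z}/2k\mathbb{Z}$. *)

(* Defs.v *)
From HB Require Import structures.
From mathcomp Require Import all_boot all_order all_algebra.
Set Implicit Arguments. Unset Strict Implicit. Unset Printing Implicit Defensive.
Import Order.TTheory GRing.Theory Num.Theory.
Local Open Scope ring_scope.

Definition is_alg_hom (K : fieldType) (A B : algType K) (f : A -> B) : Prop :=
  [/\ forall x y, f (x + y) = f x + f y,
      forall (c : K) x, f (c *: x) = c *: f x,
      forall x y, f (x * y) = f x * f y
    & f 1 = 1].

Definition ClRel2 (K : fieldType) (q : K) (n k : nat) (B : algType K)
    (psi psis om omi : 'I_n -> B) : Prop :=
  [/\ forall a b : 'I_n, psi a * psi b + psi b * psi a = 0,
      forall a b : 'I_n, psis a * psis b + psis b * psis a = 0,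
      forall a : 'I_n, psi a * psis a + q ^+ k *: (psis a * psi a) = omi a ^+ k,
      forall a : 'I_n, psi a * psis a + q ^- k *: (psis a * psi a) = om a ^+ k
    & forall a b : 'I_n, a != b -> psi a * psis b + psis b * psi a = 0].

Definition ClRel (K : fieldType) (q : K) (n k : nat) (B : algType K)
    (psi psis om omi : 'I_n -> B) : Prop :=
  [/\ forall a b : 'I_n, om a * om b = om b * om a,
      forall a : 'I_n, om a * omi a = 1 /\ omi a * om a = 1,
      forall a b : 'I_n, om a * psi b = q ^+ (a == b) *: (psi b * om a),
      forall a b : 'I_n, om a * psis b = q ^- (a == b) *: (psis b * om a)
    & ClRel2 q k psi psis om omi].

(* (A; psi, psis, om, omi) is a presentation of Cl_q(n,k): the relations hold,
   and it is initial (universal) among K-algebras with such elements. *)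
Definition is_Clq (K : fieldType) (q : K) (n k : nat) (A : algType K)
    (psi psis om omi : 'I_n -> A) : Prop :=
  ClRel q k psi psis om omi /\
  forall (B : algType K) (psiB psisB omB omiB : 'I_n -> B),
    ClRel q k psiB psisB omB omiB ->
    (exists f : A -> B, is_alg_hom f /\
       forall a, [/\ f (psi a) = psiB a, f (psis a) = psisB a,
                     f (om a) = omB a & f (omi a) = omiB a]) /\
    (forall f g : A -> B, is_alg_hom f -> is_alg_hom g ->
       (forall a, [/\ f (psi a) = g (psi a), f (psis a) = g (psis a),
                     f (om a) = g (om a) & f (omi a) = g (omi a)]) ->
       f =1 g).

Definition central (R : pzRingType) (x : R) : Prop := forall y : R, x * y = y * x.

Notation Zgrp n k := ({ffun 'I_n -> 'Z_(k.*2)}).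

(* The group algebra K[Z_{2k}^n], as functions Z_{2k}^n -> K with the
   convolution product; its unit is the indicator of 0. *)
Definition galg_mul (K : fieldType) (n k : nat) (f g : {ffun Zgrp n k -> K}) :
  {ffun Zgrp n k -> K} := [ffun m : Zgrp n k => \sum_(m1 : Zgrp n k) f m1 * g (m - m1)].
Definition galg_delta (K : fieldType) (n k : nat) (m0 : Zgrp n k) :
  {ffun Zgrp n k -> K} := [ffun m => (m == m0)%:R].

Definition unit_vec (n k : nat) (a : 'I_n) : Zgrp n k := [ffun b => (b == a)%:R].

Definition zgen (K : fieldType) (q : K) (n k : nat) (A : algType K)
    (psi psis om : 'I_n -> A) (a : 'I_n) : A :=
  q *: om a - (q - 1) *: (psi a * psis a * om a ^+ k.+1).

(* Main.v *)
Require Import Defs.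
From HB Require Import structures.
From mathcomp Require Import all_boot all_order all_algebra.
From mathcomp Require Import boolp.
Import GRing.Theory.
Local Open Scope ring_scope.
Set Implicit Arguments. Unset Strict Implicit. Unset Printing Implicit Defensive.

(** Put [T_a = psis_a om_a^k].  The relations give [psi_a T_a + T_a psi_a = 1]
    and [T_a^2 = psi_a^2 = 0], so [e_a = psi_a T_a] is idempotent; moreover
    [om_a] equals [z_a] on [e_a] and [q^-1 z_a] on [1 - e_a], [z_a] is central
    and [z_a^k = psi_a psis_a + psis_a psi_a] squares to [1].

    Let [p = \prod_a e_a], a vacuum vector: [psi_a p = 0] and [p T_a = 0].  The
    left ideal [A p] is spanned over the polynomials in the [z_a] by words in the
    [T_a] applied to [p] (a Fock space), hence [p A p = k[z] p].  So a central [x]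
    satisfies [x p = c(z) p] for some polynomial [c], and [x = c(z)] because the
    two-sided ideal generated by [p] contains [1].

    The monomials in the [z_a] are independent because [A] is graded by
    [Z_{2k}^n], with [psi_a], [psis_a], [om_a] of degrees [0], [k u_a], [u_a]
    ([u_a] the unit vectors): [z_a] has degree [u_a].  The grading is the algebra map from [A] to the group
    algebra [A[Z_{2k}^n]] provided by the universal property. *)

(** * Generation from the universal property *)

(** Zero and opposites have no constructor: they are scalings by [0] and [-1]. *)
Inductive alg_generated (K : fieldType) (A : algType K) (S : A -> Prop) : A -> Prop :=
| generated_base x : S x -> alg_generated S x
| generated1 : alg_generated S 1
| generatedZ c x : alg_generated S x -> alg_generated S (c *: x)
| generatedD x y : alg_generated S x -> alg_generated S y -> alg_generated S (x + y)
| generatedM x y : alg_generated S x -> alg_generated S y -> alg_generated S (x * y).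

Definition generated_pred (K : fieldType) (A : algType K) (S : A -> Prop) : {pred A} :=
  fun x => `[< alg_generated S x >].

Lemma generated_pred_closed (K : fieldType) (A : algType K) (S : A -> Prop) :
  GRing.subsemialg_closed (generated_pred S).
Proof.
have g0 : alg_generated S 0.
  by rewrite -(scale0r (1 : A)); apply: generatedZ; apply: generated1.
split.
- exact/asboolP/generated1.
- split; first exact/asboolP.
  by move=> x y /asboolP gx /asboolP gy; apply/asboolP/generatedD.
- by move=> c x /asboolP gx; apply/asboolP/generatedZ.
- by move=> x y /asboolP gx /asboolP gy; apply/asboolP/generatedM.
Qed.

HB.instance Definition _ (K : fieldType) (A : algType K) (S : A -> Prop) :=
  GRing.isSubalgClosed.Build K A (generated_pred S) (generated_pred_closed S).

Definition generated_sub (K : fieldType) (A : algType K) (S : A -> Prop) : Type :=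
  {x : A | generated_pred S x}.
HB.instance Definition _ (K : fieldType) (A : algType K) (S : A -> Prop) :=
  [isSub of generated_sub S for @sval A (generated_pred S)].
HB.instance Definition _ (K : fieldType) (A : algType K) (S : A -> Prop) :=
  [Choice of generated_sub S by <:].
HB.instance Definition _ (K : fieldType) (A : algType K) (S : A -> Prop) :=
  [SubChoice_isSubAlgebra of generated_sub S by <:].

Definition Clq_generator (K : fieldType) (n : nat) (A : algType K)
    (psi psis om omi : 'I_n -> A) (x : A) : Prop :=
  exists a, [\/ x = psi a, x = psis a, x = om a | x = omi a].

(* The universal property gives a map from [A] to the generated subalgebra whose
   composite with the inclusion fixes the generators, hence is the identity. *)
Lemma Clq_generated (K : fieldType) (q : K) (n k : nat) (A : algType K)
    (psi psis om omi : 'I_n -> A) (x : A) :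
  is_Clq q k psi psis om omi -> alg_generated (Clq_generator psi psis om omi) x.
Proof.
move=> [rel univ]; set S := Clq_generator _ _ _ _.
pose B := generated_sub S.
have psiP a : generated_pred S (psi a).
  by apply/asboolP/generated_base; exists a; constructor.
have psisP a : generated_pred S (psis a).
  by apply/asboolP/generated_base; exists a; constructor.
have omP a : generated_pred S (om a).
  by apply/asboolP/generated_base; exists a; constructor.
have omiP a : generated_pred S (omi a).
  by apply/asboolP/generated_base; exists a; constructor.
pose psiB a : B := Sub (psi a) (psiP a).
pose psisB a : B := Sub (psis a) (psisP a).
pose omB a : B := Sub (om a) (omP a).
pose omiB a : B := Sub (omi a) (omiP a).
have vD (u v : B) : val (u + v) = val u + val v by exact: rmorphD.
have vM (u v : B) : val (u * v) = val u * val v by exact: rmorphM.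
have vZ c (u : B) : val (c *: u) = c *: val u by exact: linearZ.
have v1 : val (1 : B) = 1 by exact: rmorph1.
have v0 : val (0 : B) = 0 by exact: raddf0.
have vX (u : B) j : val (u ^+ j) = val u ^+ j by exact: rmorphXn.
have relB : ClRel q k psiB psisB omB omiB.
  have [r1 r2 r3 r4 [r5 r6 r7 r8 r9]] := rel.
  split; last split;
    do ?[move=> a; have [] := r2 a; split | move=> *];
    by apply: val_inj; rewrite !(vD, vM, vZ, v1, v0, vX) !SubK ?r9 // => *; auto.
have [[f [[fD fZ fM f1] fg]] _] := univ B _ _ _ _ relB.
have [_ uniqA] := univ A _ _ _ _ rel.
have hid : is_alg_hom (id : A -> A) by split.
have hvf : is_alg_hom (val \o f : A -> A).
  by split=> *; rewrite /= ?fD ?fZ ?fM ?f1 ?vD ?vZ ?vM ?v1.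
have -> : x = val (f x).
  by apply: (uniqA _ _ hid hvf) => a /=; have [-> -> -> ->] := fg a.
exact/asboolP/(valP (f x)).
Qed.

(** * The group algebra [A[Z_{2k}^n]] *)

(** Only the linear structure of finite functions is copied, which leaves the product free to be
    convolution. *)
Definition conv (K : fieldType) (A : algType K) (n k : nat) : Type :=
  {ffun Zgrp n k -> A}.

HB.instance Definition _ (K : fieldType) (A : algType K) (n k : nat) :=
  GRing.Lmodule.copy (conv A n k) {ffun Zgrp n k -> A}.

Section ConvolutionAlgebra.
Variables (K : fieldType) (A : algType K) (n k : nat).
Implicit Types (x y : A) (m : Zgrp n k) (f g h : conv A n k).

(** The homogeneous element usually written [x [m]]. *)
Definition conv_single m x : conv A n k := [ffun m' => if m' == m then x else 0].
Definition conv_mul f g : conv A n k :=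
  [ffun m : Zgrp n k => \sum_(m1 : Zgrp n k) f m1 * g (m - m1)].

Lemma conv_mulA : associative conv_mul.
Proof.
move=> f g h; apply/ffunP=> m; rewrite !ffunE.
under eq_bigr do rewrite ffunE mulr_sumr.
under [RHS]eq_bigr do rewrite ffunE mulr_suml.
rewrite [RHS]exchange_big /=; apply: eq_bigr => m1 _.
rewrite [RHS](reindex_inj (addrI m1)) /=; apply: eq_bigr => m2 _.
by rewrite mulrA opprD addrA (addrC m1 m2) addrK.
Qed.

Lemma conv_single_mulE m x f m' : conv_mul (conv_single m x) f m' = x * f (m' - m).
Proof.
rewrite ffunE (bigD1 m) //= ffunE eqxx big1 ?addr0 // => m1 /negbTE m1m.
by rewrite ffunE m1m mul0r.
Qed.

Lemma conv_mul1l : left_id (conv_single 0 1) conv_mul.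
Proof. by move=> f; apply/ffunP=> m; rewrite conv_single_mulE subr0 mul1r. Qed.

Lemma conv_mul1r : right_id (conv_single 0 1) conv_mul.
Proof.
move=> f; apply/ffunP=> m; rewrite ffunE (bigD1 m) //= ffunE subrr eqxx mulr1.
rewrite big1 ?addr0 // => m1 m1m.
by rewrite ffunE subr_eq0 eq_sym (negbTE m1m) mulr0.
Qed.

Lemma conv_mulDl : left_distributive conv_mul +%R.
Proof.
move=> f g h; apply/ffunP=> m; rewrite !ffunE -big_split /=.
by apply: eq_bigr => m1 _; rewrite ffunE mulrDl.
Qed.

Lemma conv_mulDr : right_distributive conv_mul +%R.
Proof.
move=> f g h; apply/ffunP=> m; rewrite !ffunE -big_split /=.
by apply: eq_bigr => m1 _; rewrite ffunE mulrDr.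
Qed.

Lemma conv1_neq0 : conv_single 0 1 != 0 :> conv A n k.
Proof.
apply/eqP=> /ffunP/(_ 0); rewrite !ffunE eqxx => /eqP.
by rewrite (negbTE (oner_neq0 _)).
Qed.

HB.instance Definition _ := GRing.Zmodule_isNzRing.Build (conv A n k)
  conv_mulA conv_mul1l conv_mul1r conv_mulDl conv_mulDr conv1_neq0.

Lemma conv_scaleAl (c : K) f g : c *: (f * g) = c *: f * g.
Proof.
apply/ffunP=> m; rewrite !ffunE scaler_sumr.
by apply: eq_bigr => m1 _; rewrite ffunE scalerAl.
Qed.
HB.instance Definition _ := GRing.Lmodule_isLalgebra.Build K (conv A n k) conv_scaleAl.

Lemma conv_scaleAr (c : K) f g : c *: (f * g) = f * (c *: g).
Proof.
apply/ffunP=> m; rewrite !ffunE scaler_sumr.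
by apply: eq_bigr => m1 _; rewrite ffunE scalerAr.
Qed.
HB.instance Definition _ := GRing.Lalgebra_isAlgebra.Build K (conv A n k) conv_scaleAr.

Lemma conv_singleM m1 m2 x y :
  conv_single m1 x * conv_single m2 y = conv_single (m1 + m2) (x * y).
Proof.
apply/ffunP=> m; rewrite [LHS]conv_single_mulE !ffunE subr_eq addrC.
by case: eqP; rewrite ?mulr0.
Qed.

Lemma conv_singleX m x j : conv_single m x ^+ j = conv_single (m *+ j) (x ^+ j).
Proof.
elim: j => [|j IHj]; first by rewrite !expr0 mulr0n.
by rewrite !exprS IHj conv_singleM mulrS.
Qed.

Lemma conv_singleD m x y : conv_single m x + conv_single m y = conv_single m (x + y).
Proof. by apply/ffunP=> m'; rewrite !ffunE; case: eqP; rewrite ?addr0. Qed.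

Lemma conv_singleZ m (c : K) x : c *: conv_single m x = conv_single m (c *: x).
Proof. by apply/ffunP=> m'; rewrite !ffunE; case: eqP; rewrite ?scaler0. Qed.

Lemma conv_single0 m : conv_single m 0 = 0.
Proof. by apply/ffunP=> m'; rewrite !ffunE if_same. Qed.

End ConvolutionAlgebra.

Lemma unit_vec_order (n k : nat) (a : 'I_n) : (0 < k)%N -> unit_vec k a *+ k.*2 = 0.
Proof.
move=> k_gt0; apply/ffunP=> b; rewrite ffunMnE !ffunE -mulrnA mulnC mulrnA.
rewrite pchar_Zp ?mul0rn // -addnn; by case: k k_gt0 => // j _; rewrite addnS.
Qed.

(** The relations are homogeneous. The two involving [k]-th powers equate terms of degree [k u_a]
    with [omi a ^+ k], of degree [- k u_a], and with [om a ^+ k]; these degrees agree because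
    [2k u_a = 0]. *)
Lemma conv_grading (K : fieldType) (q : K) (n k : nat) (A : algType K)
    (psi psis om omi : 'I_n -> A) :
  (0 < k)%N -> ClRel q k psi psis om omi ->
  ClRel q k (fun a => conv_single (0 : Zgrp n k) (psi a))
            (fun a => conv_single (unit_vec k a *+ k) (psis a))
            (fun a => conv_single (unit_vec k a) (om a))
            (fun a => conv_single (- unit_vec k a) (omi a)).
Proof.
move=> k_gt0 [r1 r2 r3 r4 [r5 r6 r7 r8 r9]].
have dN a : - unit_vec k a *+ k = unit_vec k a *+ k.
  apply/eqP; rewrite mulNrn eq_sym -subr_eq0 opprK -mulrnDr addnn.
  by rewrite unit_vec_order.
split; last split.
- by move=> a b; rewrite !conv_singleM r1 addrC.
- by move=> a; rewrite !conv_singleM subrr addNr; have [-> ->] := r2 a.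
- by move=> a b; rewrite !conv_singleM r3 conv_singleZ addrC.
- by move=> a b; rewrite !conv_singleM r4 conv_singleZ addrC.
- by move=> a b; rewrite !conv_singleM conv_singleD r5 conv_single0.
- move=> a b; rewrite !conv_singleM [X in _ + conv_single X _]addrC.
  by rewrite conv_singleD r6 conv_single0.
- move=> a; rewrite !conv_singleM conv_singleX dN add0r addr0.
  by rewrite conv_singleZ conv_singleD r7.
- move=> a; rewrite !conv_singleM conv_singleX add0r addr0.
  by rewrite conv_singleZ conv_singleD r8.
- move=> a b ab.
  by rewrite !conv_singleM add0r addr0 conv_singleD r9 // conv_single0.
Qed.

(** * Relations between the generators *)

(** Turns self-anticommutation into vanishing squares; characteristic different from 2 enters
    here. *)
Lemma double_eq0 (K : fieldType) (V : lmodType K) (x : V) :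
  (2%:R : K) != 0 -> x + x = 0 -> x = 0.
Proof.
move=> K2 /eqP; rewrite -mulr2n -scaler_nat scaler_eq0 (negbTE K2) /=.
exact: eqP.
Qed.

Section CliffordRelations.
Variables (K : fieldType) (q : K) (n k : nat) (A : algType K).
Variables (psi psis om omi : 'I_n -> A).
Hypotheses (K2 : (2%:R : K) != 0) (q0 : q != 0).
Hypothesis rel : ClRel q k psi psis om omi.

Local Notation z := (zgen q k psi psis om).

Definition dual (a : 'I_n) : A := psis a * om a ^+ k.
Definition vac (a : 'I_n) : A := psi a * dual a.

Lemma psi_sq a : psi a * psi a = 0.
Proof. by case: rel => _ _ _ _ [r _ _ _ _]; apply: (double_eq0 K2). Qed.

Lemma psis_sq a : psis a * psis a = 0.
Proof. by case: rel => _ _ _ _ [_ r _ _ _]; apply: (double_eq0 K2). Qed.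

Lemma omC a b : GRing.comm (om a) (om b).
Proof. by case: rel => r _ _ _ _; apply: r. Qed.

Lemma omX_psi a j : om a ^+ j * psi a = q ^+ j *: (psi a * om a ^+ j).
Proof.
case: rel => _ _ r _ _; elim: j => [|j IHj].
  by rewrite !expr0 mul1r mulr1 scale1r.
rewrite [in LHS]exprS -mulrA IHj -scalerAr mulrA r eqxx expr1 -scalerAl scalerA.
by rewrite -exprSr -mulrA -exprS.
Qed.

Lemma omX_psis a j : om a ^+ j * psis a = q ^- j *: (psis a * om a ^+ j).
Proof.
case: rel => _ _ _ r _; elim: j => [|j IHj].
  by rewrite !expr0 mul1r mulr1 invr1 scale1r.
rewrite [in LHS]exprS -mulrA IHj -scalerAr mulrA r eqxx expr1 -scalerAl scalerA.
by rewrite -invfM -exprSr -mulrA -exprS.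
Qed.

Lemma om_psi_comm a b : a != b -> GRing.comm (om a) (psi b).
Proof.
by move=> /negbTE ab; case: rel => _ _ r _ _; rewrite /GRing.comm r ab scale1r.
Qed.

Lemma om_psis_comm a b : a != b -> GRing.comm (om a) (psis b).
Proof.
move=> /negbTE ab; case: rel => _ _ _ r _.
by rewrite /GRing.comm r ab expr0 invr1 scale1r.
Qed.

Lemma omi_omX a j : omi a ^+ j * om a ^+ j = 1.
Proof.
case: rel => _ r _ _ _; have [wv vw] := r a.
by rewrite -exprMn_comm ?vw ?expr1n // /GRing.comm wv vw.
Qed.

Lemma psis_psi_psis a : psis a * psi a * psis a = dual a.
Proof.
case: rel => _ _ _ _ [_ _ _ r _]; rewrite /dual -r mulrDr -scalerAr.
by rewrite !mulrA psis_sq mul0r scaler0 addr0.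
Qed.

(** Multiplied on the left by [psis a], both [k]-th power relations have left side
    [psis a * psi a * psis a]; hence [psis a] times [om a ^+ k] or times [omi a ^+ k] is the same
    element. *)
Lemma dual_om a : dual a * om a ^+ k = psis a.
Proof.
have <- : psis a * omi a ^+ k = dual a.
  rewrite -psis_psi_psis; case: rel => _ _ _ _ [_ _ r _ _].
  by rewrite -r mulrDr -scalerAr !mulrA psis_sq mul0r scaler0 addr0.
by rewrite -mulrA omi_omX mulr1.
Qed.

Lemma dual_psi a : dual a * psi a = q ^+ k *: (psis a * psi a * om a ^+ k).
Proof. by rewrite /dual -mulrA omX_psi -scalerAr mulrA. Qed.

(** The sum is [psi a * psis a + q ^+ k *: (psis a * psi a)], that is [omi a ^+ k], times
    [om a ^+ k]. *)
Lemma vacD a : vac a + dual a * psi a = 1.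
Proof.
rewrite dual_psi /vac /dual mulrA scalerAl -mulrDl.
by case: rel => _ _ _ _ [_ _ -> _ _]; rewrite omi_omX.
Qed.

Lemma dual_psiE a : dual a * psi a = 1 - vac a.
Proof. by rewrite -(vacD a) addrC addKr. Qed.

Lemma dual_sq a : dual a * dual a = 0.
Proof.
rewrite /dual mulrA -[_ * psis a]mulrA omX_psis -scalerAr mulrA psis_sq.
by rewrite mul0r scaler0 mul0r.
Qed.

Lemma psi_vac a : psi a * vac a = 0.
Proof. by rewrite mulrA psi_sq mul0r. Qed.

Lemma vac_dual a : vac a * dual a = 0.
Proof. by rewrite -mulrA dual_sq mulr0. Qed.

Lemma vac_psi a : vac a * psi a = psi a.
Proof. by rewrite -mulrA dual_psiE mulrBr mulr1 psi_vac subr0. Qed.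

Lemma dual_vac a : dual a * vac a = dual a.
Proof. by rewrite mulrA dual_psiE mulrBl mul1r vac_dual subr0. Qed.

Lemma vac_idem a : vac a * vac a = vac a.
Proof. by rewrite {2}/vac mulrA vac_psi. Qed.

Lemma om_dual a : om a * dual a = q^-1 *: (dual a * om a).
Proof.
rewrite /dual mulrA (omX_psis a 1) -scalerAl -!mulrA.
by rewrite (commrX k (commr_refl (om a))).
Qed.

Lemma om_dual_comm a b : a != b -> GRing.comm (om a) (dual b).
Proof.
by move=> ab; apply: commrM; [apply: om_psis_comm | apply/commrX/omC].
Qed.

Lemma om_vac a b : GRing.comm (om a) (vac b).
Proof.
have [<-|ab] := eqVneq a b; last first.
  by apply: commrM; [apply: om_psi_comm | apply: om_dual_comm].
rewrite /GRing.comm mulrA (omX_psi a 1) -scalerAl -mulrA om_dual -scalerAr.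
by rewrite scalerA mulfV // scale1r mulrA.
Qed.

Lemma psi_anti a b : psi a * psi b = - (psi b * psi a).
Proof. by case: rel => _ _ _ _ [r _ _ _ _]; apply/eqP; rewrite -addr_eq0 r. Qed.

Lemma psi_dual_anti a b : a != b -> psi a * dual b = - (dual b * psi a).
Proof.
move=> ab; case: rel => _ _ _ _ [_ _ _ _ r].
rewrite /dual -mulrA (commr_sym (commrX k (commr_sym (om_psi_comm _)))) 1?eq_sym //.
by rewrite !mulrA -mulNr; congr (_ * _); apply/eqP; rewrite -addr_eq0 r.
Qed.

Lemma dual_anti a b : a != b -> dual a * dual b = - (dual b * dual a).
Proof.
(* Gathering the powers of [om] on the right reduces the claim to the [psis]. *)
have swap c d : c != d ->
    dual c * dual d = psis c * psis d * (om c ^+ k * om d ^+ k).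
  move=> cd; rewrite /dual -mulrA [om c ^+ k * _]mulrA.
  by rewrite (commr_sym (commrX k (commr_sym (om_psis_comm cd)))) !mulrA.
move=> ab; have ba : b != a by rewrite eq_sym.
rewrite !swap //.
rewrite (commrX k (commr_sym (commrX k (omC b a)))).
rewrite -mulNr; congr (_ * _); apply/eqP; rewrite -addr_eq0.
by case: rel => _ _ _ _ [_ -> _ _ _].
Qed.

(** Two signs cancel; this makes the quadratic [vac a] commute with generators of other indices. *)
Lemma anti_comm (x y t : A) : x * t = - (t * x) -> y * t = - (t * y) ->
  GRing.comm (x * y) t.
Proof.
move=> xt yt; rewrite /GRing.comm -mulrA yt mulrN [x * (t * y)]mulrA xt.
by rewrite mulNr opprK mulrA.
Qed.

Lemma vac_psi_comm a b : a != b -> GRing.comm (vac a) (psi b).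
Proof.
move=> ab; apply: anti_comm; first exact: psi_anti.
by rewrite psi_dual_anti ?opprK // eq_sym.
Qed.

Lemma vac_dual_comm a b : a != b -> GRing.comm (vac a) (dual b).
Proof. by move=> ab; apply: anti_comm; [apply: psi_dual_anti | apply: dual_anti]. Qed.

Lemma vacC a b : GRing.comm (vac a) (vac b).
Proof.
have [->|ab] := eqVneq a b; first exact: commr_refl.
by apply: commrM; [apply: vac_psi_comm | apply: vac_dual_comm].
Qed.

(** * The elements [z_a]: centrality and powers *)

Lemma zgenE a : z a = q *: om a - (q - 1) *: (vac a * om a).
Proof. by rewrite /zgen /vac /dual exprSr !mulrA. Qed.

Lemma zgen_vac a : z a * vac a = om a * vac a.
Proof.
rewrite zgenE mulrBl -!scalerAl -mulrA (om_vac a a) mulrA vac_idem -scalerBl.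
by rewrite subKr scale1r.
Qed.

Lemma zgen_covac a : z a * (1 - vac a) = q *: (om a * (1 - vac a)).
Proof.
have e0 : vac a * om a * (1 - vac a) = 0.
  by rewrite -om_vac -mulrA mulrBr mulr1 vac_idem subrr mulr0.
by rewrite zgenE mulrBl -!scalerAl e0 scaler0 subr0.
Qed.

Lemma comm_zgen x a : GRing.comm x (om a) -> GRing.comm x (vac a) -> GRing.comm x (z a).
Proof.
move=> xw xe; rewrite zgenE /GRing.comm mulrBr mulrBl -!scalerAr -!scalerAl.
by rewrite xw (commrM xe xw).
Qed.

(** For equal indices, [e_a psi_a = psi_a] and [psi_a e_a = 0] make both products equal to
    [q psi_a om_a]. In [dual_zgen] the mirrored identities give [T_a om_a]. *)
Lemma psi_zgen a b : GRing.comm (psi b) (z a).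
Proof.
have [->|ab] := eqVneq b a; last first.
  apply: comm_zgen; apply: commr_sym; first by apply: om_psi_comm; rewrite eq_sym.
  by apply: vac_psi_comm; rewrite eq_sym.
rewrite /GRing.comm zgenE mulrBr mulrBl -!scalerAr -!scalerAl mulrA psi_vac mul0r.
rewrite scaler0 subr0 -mulrA (omX_psi a 1) -scalerAr mulrA vac_psi -scalerBl.
by rewrite subKr scale1r.
Qed.

Lemma dual_zgen a b : GRing.comm (dual b) (z a).
Proof.
have [->|ab] := eqVneq b a; last first.
  apply: comm_zgen; apply: commr_sym; first by apply: om_dual_comm; rewrite eq_sym.
  by apply: vac_dual_comm; rewrite eq_sym.
rewrite /GRing.comm zgenE mulrBr mulrBl -!scalerAr -!scalerAl mulrA dual_vac.
rewrite -scalerBl subKr scale1r -[vac a * om a * _]mulrA om_dual -scalerAr.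
rewrite [vac a * _]mulrA vac_dual.
by rewrite mul0r !scaler0 subr0 scalerA mulfV // scale1r.
Qed.

Lemma om_zgen a b : GRing.comm (om b) (z a).
Proof. exact: comm_zgen (omC b a) (om_vac b a). Qed.

Lemma zgen_central_generated a x :
  alg_generated (Clq_generator psi psis om omi) x -> GRing.comm x (z a).
Proof.
elim=> {x} [x [b []->]||c x _ IHx|x y _ IHx _ IHy|x y _ IHx _ IHy].
- exact: psi_zgen.
(* [psis b] is a product of [dual b] and a power of [om b], both already treated. *)
- rewrite -dual_om; apply: commr_sym; apply: commrM.
    exact/commr_sym/dual_zgen.
  exact/commrX/commr_sym/om_zgen.
- exact: om_zgen.
- case: rel => _ r _ _ _; have [wv vw] := r b.
  rewrite /GRing.comm -[LHS]mulr1 -wv mulrA -[_ * z a * om b]mulrA -om_zgen.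
  by rewrite !mulrA vw mul1r.
- exact/commr_sym/commr1.
- by rewrite /GRing.comm -scalerAl -scalerAr IHx.
- by rewrite /GRing.comm mulrDl IHx IHy -mulrDr.
- by rewrite /GRing.comm -mulrA IHy [LHS]mulrA IHx -mulrA.
Qed.

Lemma zgenX_vac a j : z a ^+ j * vac a = om a ^+ j * vac a.
Proof.
elim: j => [|j IHj]; first by rewrite !expr0.
rewrite exprSr -mulrA zgen_vac om_vac mulrA IHj -mulrA.
by rewrite -om_vac mulrA -exprSr.
Qed.

Lemma zgenX_covac a j : z a ^+ j * (1 - vac a) = q ^+ j *: (om a ^+ j * (1 - vac a)).
Proof.
have wf : GRing.comm (om a) (1 - vac a) by apply: commrB (commr1 _) (om_vac a a).
elim: j => [|j IHj]; first by rewrite !expr0 scale1r.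
rewrite exprSr -mulrA zgen_covac -scalerAr wf mulrA IHj -scalerAl scalerA -mulrA.
by rewrite -wf mulrA -exprSr -exprS.
Qed.

(** Split along [1 = e_a + T_a psi_a]: the first part gives [psi a * psis a], the second
    [psis a * psi a], the factor [q ^+ k] being absorbed by moving [om a ^+ k] past [psis a]. *)
Lemma zgenXk a : z a ^+ k = psi a * psis a + psis a * psi a.
Proof.
rewrite -[LHS]mulr1 -(vacD a) mulrDr zgenX_vac dual_psiE zgenX_covac -dual_psiE.
congr (_ + _).
  rewrite (commr_sym (commrX k (commr_sym (om_vac a a)))) /vac -mulrA.
  by rewrite dual_om.
rewrite mulrA /dual mulrA omX_psis -!scalerAl scalerA mulfV ?expf_neq0 // scale1r.
by rewrite -[psis a * _ ^+ _]/(dual a) dual_om.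
Qed.

(** On squaring [zgenXk] the cross terms contain a square of [psi a] or [psis a]; the others reduce
    to [vacD] by [psis_psi_psis]. *)
Lemma zgenX2k a : z a ^+ k.*2 = 1.
Proof.
rewrite -addnn exprD zgenXk mulrDl !mulrDr.
rewrite [psi a * psis a * (psis a * _)]mulrA -[psi a * psis a * psis a]mulrA psis_sq.
rewrite [psis a * psi a * (psi a * _)]mulrA -[psis a * psi a * psi a]mulrA psi_sq.
rewrite !mulr0 !mul0r addr0 add0r !mulrA -[psi a * _ * _ * _]mulrA -[psi a * _ * _]mulrA.
by rewrite [psis a * (psi a * _)]mulrA psis_psi_psis vacD.
Qed.

(** * The remaining generators through [psi_a], [T_a] and [z_a] *)

Lemma psisE a : psis a = dual a * z a ^+ k.
Proof.
have -> : dual a = psis a * z a ^+ k.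
  by rewrite zgenXk mulrDr !mulrA psis_sq mul0r addr0 psis_psi_psis.
by rewrite -mulrA -exprD addnn zgenX2k mulr1.
Qed.

Lemma omE a : om a = z a * vac a + q^-1 *: (z a * (1 - vac a)).
Proof.
by rewrite zgen_vac zgen_covac scalerA mulVf // scale1r -mulrDr addrC subrK mulr1.
Qed.

(** Since [z_a ^+ 2k = 1], the power [2k - 1] is the inverse of [z_a]; inverting [omE] on [e_a] and
    on [1 - e_a] gives the formula. *)
Lemma omiE a : (0 < k)%N -> GRing.comm (omi a) (z a) ->
  omi a = z a ^+ (k.*2).-1 * vac a + q *: (z a ^+ (k.*2).-1 * (1 - vac a)).
Proof.
move=> k_gt0 vz; set zi := z a ^+ _.
have ziz : zi * z a = 1 by rewrite -exprSr prednK ?double_gt0 // zgenX2k.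
have viz : GRing.comm (omi a) zi by apply: commrX.
have vw : omi a * om a = 1 by case: rel => _ r _ _ _; have [] := r a.
have ve : zi * vac a = omi a * vac a.
  rewrite -[vac a in LHS]mul1r -vw -mulrA -zgen_vac !mulrA -viz.
  by rewrite -(mulrA _ zi) ziz mulr1.
have vf : q *: (zi * (1 - vac a)) = omi a * (1 - vac a).
  have -> : zi * (1 - vac a) = zi * (omi a * (om a * (1 - vac a))).
    by rewrite [omi a * _]mulrA vw mul1r.
  by rewrite 2!scalerAr -zgen_covac !mulrA -viz -(mulrA _ zi) ziz mulr1.
by rewrite ve vf -mulrDr addrC subrK mulr1.
Qed.

End CliffordRelations.

(** * The center *)

Section Center.
Variables (K : fieldType) (q : K) (n k : nat) (A : algType K).
Variables (psi psis om omi : 'I_n -> A).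
Hypotheses (K2 : (2%:R : K) != 0) (q0 : q != 0) (k_gt0 : (0 < k)%N).
Hypothesis Clq : is_Clq q k psi psis om omi.

Let rel : ClRel q k psi psis om omi := proj1 Clq.
Local Notation z := (zgen q k psi psis om).
Local Notation T := (dual k psis om).
Local Notation e := (vac k psi psis om).
Local Notation G := (Zgrp n k).

Lemma zgen_comm a x : GRing.comm x (z a).
Proof. exact: (zgen_central_generated K2 q0 rel a (Clq_generated x Clq)). Qed.

(** * Monomials in the [z_a] and the map from the group algebra *)

Definition zmon (m : G) : A := \prod_a z a ^+ m a.
Definition zphi (f : {ffun G -> K}) : A := \sum_m f m *: zmon m.

Lemma zmon_comm m x : GRing.comm x (zmon m).
Proof. by apply: commr_prod => a _; apply/commrX/zgen_comm. Qed.

Lemma zphi_comm f x : GRing.comm x (zphi f).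
Proof.
by apply: commr_sum => m _; rewrite /GRing.comm -scalerAl -scalerAr zmon_comm.
Qed.

(** ['Z_p] has [p] elements only for [p > 1], so [Zp_cast] needs this bound. *)
Lemma double_k_gt1 : (1 < k.*2)%N.
Proof. by rewrite -addnn (leq_add k_gt0 k_gt0). Qed.

Lemma zmon0 : zmon 0 = 1.
Proof. by rewrite /zmon big1 // => a _; rewrite ffunE. Qed.

Lemma zmonD m1 m2 : zmon (m1 + m2) = zmon m1 * zmon m2.
Proof.
rewrite -prodrM_comm => [|a b _ _]; last exact/commrX/zgen_comm.
apply: eq_bigr => a _; rewrite ffunE -exprD /=.
by rewrite expr_mod // Zp_cast ?double_k_gt1 // (zgenX2k K2 q0 rel).
Qed.

Lemma zmonMn m j : zmon (m *+ j) = zmon m ^+ j.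
Proof.
elim: j => [|j IHj]; first by rewrite mulr0n zmon0.
by rewrite mulrS zmonD IHj exprS.
Qed.

Lemma zmonN m : zmon m * zmon (- m) = 1.
Proof. by rewrite -zmonD subrr zmon0. Qed.

Lemma zmon_unit_vec a : zmon (unit_vec k a) = z a.
Proof.
rewrite /zmon (eq_bigr (fun b => if b == a then z b else 1)) => [|b _].
  by rewrite -big_mkcond big_pred1_eq.
by rewrite ffunE; case: (b == a).
Qed.

Lemma zphiD f g : zphi (f + g) = zphi f + zphi g.
Proof. by rewrite -big_split; apply: eq_bigr => m _; rewrite ffunE scalerDl. Qed.

Lemma zphiZ (c : K) (f : {ffun G -> K}) : zphi [ffun m => c * f m] = c *: zphi f.
Proof. by rewrite scaler_sumr; apply: eq_bigr => m _; rewrite ffunE scalerA. Qed.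

Lemma zphi_delta m : zphi (galg_delta K m) = zmon m.
Proof.
rewrite /zphi (bigD1 m) //= ffunE eqxx scale1r big1 ?addr0 // => m' /negbTE m'm.
by rewrite ffunE m'm scale0r.
Qed.

Lemma zphiM f g : zphi (galg_mul f g) = zphi f * zphi g.
Proof.
rewrite /zphi; under eq_bigr do rewrite ffunE scaler_suml.
rewrite exchange_big mulr_suml /=; apply: eq_bigr => m1 _.
rewrite (reindex_inj (addrI m1)) mulr_sumr /=; apply: eq_bigr => m2 _.
by rewrite (addrC m1 m2) addrK -scalerAl -scalerAr scalerA addrC zmonD.
Qed.

(** * Linear independence of the monomials *)

Lemma unit_vec_sum (m : G) : \sum_a unit_vec k a *+ m a = m.
Proof.
apply/ffunP=> b; rewrite sum_ffunE (bigD1 b) //= big1 => [|a ab].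
  by rewrite ffunMnE ffunE eqxx addr0 natr_Zp.
by rewrite ffunMnE ffunE eq_sym (negbTE ab) mul0rn.
Qed.

Lemma zmon_coaction : exists theta : A -> conv A n k,
  is_alg_hom theta /\ forall m, theta (zmon m) = conv_single m (zmon m).
Proof.
have [_ univ] := Clq.
have [[th [th_hom thE]] _] := univ _ _ _ _ _ (conv_grading k_gt0 rel).
exists th; split=> // m; have [thD thZ thM th1] := th_hom.
have thX x j : th (x ^+ j) = th x ^+ j.
  by elim: j => [|j IHj]; rewrite ?expr0 // !exprS thM IHj.
have thz a : th (z a) = conv_single (unit_vec k a) (z a).
  (* Both terms of [z a] have degree [u_a]: for the second, [k + (k + 1) = 1] modulo [2k]. *)
  rewrite /zgen -scaleN1r !(thD, thZ, thM, thX); have [-> -> -> _] := thE a.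
  rewrite conv_singleX !conv_singleM add0r mulrS addrCA -mulrnDr addnn.
  by rewrite unit_vec_order // addr0 !conv_singleZ conv_singleD.
rewrite /zmon (big_morph th thM th1).
rewrite -[X in _ = conv_single X _]unit_vec_sum.
elim/big_rec3: _ => [|a x y s _ ->]; first by [].
by rewrite thX thz conv_singleX conv_singleM.
Qed.

(** The component of degree [m] of the image under the grading map is [c m *: zmon m], and [zmon m]
    is invertible. *)
Lemma zmon_free (c : G -> K) : \sum_m c m *: zmon m = 0 -> forall m, c m = 0.
Proof.
move=> c0 m; have [th [[thD thZ thM th1] thE]] := zmon_coaction.
have th0 : th 0 = 0 by rewrite -(scale0r 0) thZ scale0r.
have /ffunP/(_ m) : th (\sum_m' c m' *: zmon m') = 0 by rewrite c0.
rewrite (big_morph th thD th0) sum_ffunE (bigD1 m) //= big1 => [|m' m'm]; last first.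
  by rewrite thZ thE !ffunE eq_sym (negbTE m'm) scaler0.
rewrite thZ thE !ffunE eqxx addr0 => /(congr1 (fun x => x * zmon (- m))) /eqP.
by rewrite -scalerAl zmonN mul0r scaler_eq0 oner_eq0 orbF => /eqP.
Qed.

Lemma zphi_inj : injective zphi.
Proof.
move=> f g fg; apply/ffunP=> m; apply/eqP; rewrite -subr_eq0; apply/eqP.
apply: (zmon_free (c := fun m => f m - g m)).
under eq_bigr do rewrite scalerBl.
by rewrite big_split sumrN /= -[\sum_m f m *: _]/(zphi f) fg subrr.
Qed.

Lemma zmon_inj : injective zmon.
Proof.
move=> m1 m2; rewrite -!zphi_delta => /zphi_inj/ffunP/(_ m1); rewrite !ffunE eqxx.
by case: eqP => // _ /eqP; rewrite oner_eq0.
Qed.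

Lemma zgen_order a j : (0 < j < k.*2)%N -> z a ^+ j != 1.
Proof.
case/andP=> j0 jk; rewrite -zmon_unit_vec -zmonMn -zmon0; apply/eqP.
move=> /zmon_inj/ffunP/(_ a); rewrite ffunMnE !ffunE eqxx -mulrnA mul1n Zp_nat.
move=> /(congr1 val) /=; rewrite Zp_cast ?double_k_gt1 // modn_small // => j00.
by rewrite j00 in j0.
Qed.

(** * The vacuum and the Fock space *)

Definition vacuum : A := \prod_a e a.
Local Notation p := vacuum.

(** [psi a] commutes past the other factors until it meets [e_a], which it kills. *)
Lemma psi_vacuum a : psi a * p = 0.
Proof.
rewrite /p; have : a \in index_enum 'I_n by exact: mem_index_enum.
elim: (index_enum _) => // b r IHr; rewrite inE big_cons mulrA.
have [<- _|ab /= ar] := eqVneq a b; first by rewrite (psi_vac K2 rel) mul0r.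
by rewrite -(vac_psi_comm rel) 1?eq_sym // -mulrA IHr // mulr0.
Qed.

Lemma vacuum_dual a : p * T a = 0.
Proof.
rewrite /p; have : a \in index_enum 'I_n by exact: mem_index_enum.
elim: (index_enum _) => // b r IHr; rewrite inE big_cons -mulrA.
have [<- /= _|ab /= ar] := eqVneq a b; last by rewrite IHr // mulr0.
(* If [a] recurs in the tail, induction applies; otherwise [T a] commutes with the tail and meets
   [e_a]. *)
have [ar|ar] := boolP (a \in r); first by rewrite IHr // mulr0.
have Tr : GRing.comm (T a) (\prod_(j <- r) e j).
  rewrite big_seq; apply: commr_prod => c cr; apply/commr_sym/(vac_dual_comm rel).
  by apply: contraNneq ar => <-.
by rewrite -Tr mulrA (vac_dual K2 rel) mul0r.
Qed.

Lemma vacuum_idem : p * p = p.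
Proof.
rewrite /p -prodrM_comm => [|a b _ _]; last exact: (vacC rel).
by apply: eq_bigr => a _; rewrite (vac_idem K2 rel).
Qed.

(** The factors [e_a] are stripped off one at a time; the index list is kept duplicate-free so that
    [psi a] commutes with the remaining product. *)
Lemma central_vacuum_eq0 y : central y -> y * p = 0 -> y = 0.
Proof.
move=> yC; rewrite /p; have : uniq (index_enum 'I_n) by exact: index_enum_uniq.
elim: (index_enum _) => [|a r IHr] /=; first by rewrite big_nil mulr1.
case/andP=> ar ur; rewrite big_cons => y0; apply: IHr => //.
set Q := \prod_(j <- r) e j in y0 *.
have PQ : GRing.comm (psi a) Q.
  rewrite /Q big_seq; apply: commr_prod => b br; apply/commr_sym/(vac_psi_comm rel).
  by apply: contraNneq ar => <-.
(* [1 = e a + T a * e a * psi a], and [y] and [Q] move past [T a] and [psi a]. *)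
have eP := vac_psi K2 rel a; rewrite -[Q]mul1r -(vacD rel a) mulrDl mulrDr y0 add0r.
move: (e a) (T a) eP y0 => E t EP y0; rewrite -EP.
have -> : y * (t * (E * psi a) * Q) = t * (y * (E * Q)) * psi a.
  by rewrite -!mulrA PQ [y * (t * _)]mulrA (yC t) -mulrA.
by rewrite y0 mulr0 mul0r.
Qed.

(** The left ideal [A p]. Stability under [psi a] is derived rather than built in, so [vacuum_fock]
    only has to treat words in [T_a] and [z_a]. *)
Inductive fock : A -> Prop :=
| fock_vacuum : fock p
| fock_dual a x : fock x -> fock (T a * x)
| fock_zgen a x : fock x -> fock (z a * x)
| fockZ c x : fock x -> fock (c *: x)
| fockD x y : fock x -> fock y -> fock (x + y).

Lemma fock0 : fock 0.
Proof. by rewrite -(scale0r p); apply/fockZ/fock_vacuum. Qed.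

Lemma fockN x : fock x -> fock (- x).
Proof. by rewrite -scaleN1r; apply: fockZ. Qed.

(** [psi a] acts as an annihilation operator: it moves right by [psi_a T_a = 1 - T_a psi_a], or by
    anticommutation for distinct indices, until it kills [p]. *)
Lemma fock_psi a x : fock x -> fock (psi a * x).
Proof.
elim=> {x} [|b x fx IHx|b x _ IHx|c x _ IHx|x y _ IHx _ IHy].
- by rewrite psi_vacuum; apply: fock0.
- have [<-|ab] := eqVneq a b; last first.
    by rewrite mulrA (psi_dual_anti rel) // mulNr -mulrA; apply/fockN/fock_dual.
  have -> : psi a * (T a * x) = x - T a * (psi a * x).
    by rewrite [T a * (psi a * x)]mulrA (dual_psiE rel) mulrBl mul1r subKr mulrA.
  by apply: fockD => //; apply/fockN/fock_dual.
- by rewrite mulrA zgen_comm -mulrA; apply: fock_zgen.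
- by rewrite -scalerAr; apply: fockZ.
- by rewrite mulrDr; apply: fockD.
Qed.

Lemma fock_zgenX a j x : fock x -> fock (z a ^+ j * x).
Proof.
move=> fx; elim: j => [|j IHj]; first by rewrite mul1r.
by rewrite exprS -mulrA; apply: fock_zgen.
Qed.

Lemma fock_vac a x : fock x -> fock (e a * x).
Proof. by move=> fx; rewrite /vac -mulrA; apply/fock_psi/fock_dual. Qed.

Lemma fock_covac a x : fock x -> fock ((1 - e a) * x).
Proof. by move=> fx; rewrite mulrBl mul1r; apply/fockD/fockN/fock_vac. Qed.

Lemma fock_stable x y : fock y -> fock (x * y).
Proof.
(* Generality in [y] lets a product act as two successive operators. *)
move: y; elim: (Clq_generated x Clq) => {x}
  [x [a []->]||c x _ IHx|x x' _ IHx _ IHx'|x x' _ IHx _ IHx'] y fy.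
- exact: fock_psi.
- rewrite (psisE K2 q0 rel) -mulrA; exact/fock_dual/fock_zgenX.
- rewrite (omE K2 q0 rel) mulrDl -scalerAl
    -(mulrA _ (e a)) -(mulrA _ (1 - e a)).
  by apply: fockD; [apply/fock_zgen/fock_vac | apply/fockZ/fock_zgen/fock_covac].
- rewrite (omiE K2 q0 rel k_gt0 (zgen_comm a _)) mulrDl -scalerAl
    -(mulrA _ (e a)) -(mulrA _ (1 - e a)).
  by apply: fockD; [apply/fock_zgenX/fock_vac | apply/fockZ/fock_zgenX/fock_covac].
- by rewrite mul1r.
- by rewrite -scalerAl; apply/fockZ/IHx.
- by rewrite mulrDl; apply: fockD; [apply: IHx | apply: IHx'].
- by rewrite -mulrA; apply/IHx/IHx'.
Qed.

(** [p T_a = 0] removes every word beginning with some [T_a], while the central [z_a] move out of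
    the way. *)
Lemma vacuum_fock x : fock x -> exists f, p * x = zphi f * p.
Proof.
elim=> {x} [|a x _ _|a x _ [f IHx]|c x _ [f IHx]|x y _ [f IHx] _ [g IHy]].
- by exists (galg_delta K 0); rewrite zphi_delta zmon0 vacuum_idem mul1r.
- exists (0 : {ffun G -> K}); rewrite mulrA vacuum_dual mul0r /zphi.
  by rewrite big1 ?mul0r // => m _; rewrite ffunE scale0r.
- exists (galg_mul (galg_delta K (unit_vec k a)) f).
  by rewrite zphiM zphi_delta zmon_unit_vec mulrA zgen_comm -!mulrA IHx.
- by exists [ffun m => c * f m]; rewrite zphiZ -scalerAr IHx scalerAl.
- by exists (f + g); rewrite zphiD mulrDr IHx IHy mulrDl.
Qed.

Lemma central_zphi x : central x <-> exists f, zphi f = x.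
Proof.
split=> [xC|[f <-] y]; last by rewrite zphi_comm.
have [f pxp] := vacuum_fock (fock_stable x fock_vacuum).
exists f; apply/eqP; rewrite eq_sym -subr_eq0; apply/eqP.
apply: central_vacuum_eq0 => [y|].
  by rewrite mulrBl mulrBr xC zphi_comm.
(* Centrality and [p * p = p] give [x * p = p * (x * p)]. *)
by rewrite mulrBl -pxp xC [p * (p * x)]mulrA vacuum_idem subrr.
Qed.

End Center.

Theorem theorem3p12 (K : fieldType) (q : K) (n k : nat)
    (A : algType K) (psi psis om omi : 'I_n -> A) :
  (2%:R : K) != 0 -> q != 0 -> (0 < n)%N -> (0 < k)%N ->
  is_Clq q k psi psis om omi ->
  let z := zgen q k psi psis om in
  (* Z_q(n,k) is isomorphic (as K-algebra) to K[Z_{2k}^n], via an isomorphism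
     sending the generator e_a of Z_{2k}^n to z_a *)
  (exists phi : {ffun Zgrp n k -> K} -> A,
     [/\ (forall f g, phi (f + g) = phi f + phi g) /\
         (forall (c : K) (f : {ffun Zgrp n k -> K}), phi [ffun m => c * f m] = c *: phi f),
         (forall f g, phi (galg_mul f g) = phi f * phi g) /\
         phi (galg_delta K (0 : Zgrp n k)) = 1,
         injective phi,
         (forall x : A, central x <-> exists f, phi f = x)
       & forall a, phi (galg_delta K (unit_vec k a)) = z a]) /\
  (* each z_a has order 2k *)
  (forall a : 'I_n, z a ^+ k.*2 = 1 /\
     forall j : nat, (0 < j < k.*2)%N -> z a ^+ j != 1) /\
  (* dim Z_q(n,k) = (2k)^n: a basis of the center indexed by Z_{2k}^n *)
  (exists b : Zgrp n k -> A,
     [/\ (#|{: Zgrp n k}| = (k.*2) ^ n)%N,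
         forall m, central (b m),
         forall c : Zgrp n k -> K, \sum_m c m *: b m = 0 -> forall m, c m = 0
       & forall x : A, central x -> exists c : Zgrp n k -> K, x = \sum_m c m *: b m]) /\
  (forall a : 'I_n, psi a * psis a + psis a * psi a = z a ^+ k).
Proof.
move=> K2 q0 _ k_gt0 Clq z; have rel := proj1 Clq; split; last split; last split.
- exists (zphi q psi psis om); split.
  + by split; [apply: zphiD | apply: zphiZ].
  + split; first exact: (zphiM K2 q0 k_gt0 Clq).
    by rewrite zphi_delta zmon0.
  + exact: (zphi_inj K2 q0 k_gt0 Clq).
  + exact: (central_zphi K2 q0 k_gt0 Clq).
  + by move=> a; rewrite zphi_delta zmon_unit_vec.
- move=> a; split; first exact: (zgenX2k K2 q0 rel).
  exact: (zgen_order K2 q0 k_gt0 Clq).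
- exists (zmon q psi psis om); split.
  + by rewrite card_ffun !card_ord Zp_cast ?double_k_gt1.
  + by move=> m y; rewrite (zmon_comm K2 q0 Clq).
  + exact: (zmon_free K2 q0 k_gt0 Clq).
  + by move=> x /(central_zphi K2 q0 k_gt0 Clq) [f <-]; exists f.
- by move=> a; rewrite -(zgenXk K2 q0 rel).
Qed.
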